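(* Let $f:\operatorname{dom} f\subseteq\mathbb{R}^n\to\mathbb{R}$ be $\mathcal{C}^4$ on $B(x^0,\overline{\Delta})$, where $x^0\in\operatorname{dom} f$ and $\overline{\Delta}>0$, and suppose $\nabla^3 f$ is Lipschitz continuous on $\overline{B}(x^0,\overline{\Delta})$ with Lipschitz constant $L_{\nabla^3 f}$. Let $S=[s^1\ s^2\ \cdots\ s^m]\in\mathbb{R}^{n\times m}$ and $T_i=[t_i^1\ t_i^2\ \cdots\ t_i^{k_i}]\in\mathbb{R}^{n\times k_i}$ for $i\in\{1,\dots,m\}$ be nonzero matrices with $\overline{B}(x^0\pm s^i,\Delta_{T_i})\subset B(x^0,\overline{\Delta})$ for all $i\in\{1,\dots,m\}$. Then the following hold. (i) If $S$ has full column rank, or if $T_i$ has full row rank for all $i\in\{1,\dots,m\}$, then $$\|\operatorname{Proj}_{S,T_{1:m}}\nabla_c^2 f(x^0;S,T_{1:m})-\operatorname{Proj}_{S,T_{1:m}}\nabla^2 f(x^0)\|=\|\nabla_c^2 f(x^0;S,T_{1:m})-\operatorname{Proj}_{S,T_{1:m}}\nabla^2 f(x^0)\|$$ $$\le 2m\sqrt{k}\,L_{\nabla^3 f}\left(\frac{\Delta_u}{\Delta_l}\right)^2\|(\widehat{S}^\top)^\dagger\|\,\|\widehat{T}^\dagger\|\,\Delta_u^2 .$$ (ii) If $T_1=T_2=\cdots=T_m=:\overline{T}\in\mathbb{R}^{n\times k}$, then $$\|\operatorname{Proj}_{S,\overline{T}}\nabla_c^2 f(x^0;S,\overline{T})-\operatorname{Proj}_{S,\overline{T}}\nabla^2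 f(x^0)\|=\|\nabla_c^2 f(x^0;S,\overline{T})-\operatorname{Proj}_{S,\overline{T}}\nabla^2 f(x^0)\|$$ $$\le 2\sqrt{mk}\,L_{\nabla^3 f}\,\frac{\Delta_u}{\Delta_l}\,\|(\widehat{S}^\top)^\dagger\|\,\|\widehat{T}^\dagger\|\,\Delta_u^2 .$$
   Context: $B(x,\Delta)$ and $\overline{B}(x,\Delta)$ are the open and closed Euclidean balls. $\|\cdot\|$ is the Euclidean norm for vectors and the induced (spectral) norm for matrices; the Lipschitz constant of $\nabla^3 f$ is with respect to the induced (operator) norm on trilinear forms. $A^\dagger$ is the Moore–Penrose pseudoinverse of $A$. $e_m^i$ is the $i$-th standard basis vector of $\mathbb{R}^m$. For $x\in\operatorname{dom} f$ and $T=[t^1\cdots t^k]\in\mathbb{R}^{n\times k}$ with all $x+t^j\in\operatorname{dom} f$, let $\delta_s(x;T)\in\mathbb{R}^k$ be the vector with entries $f(x+t^j)-f(x)$. The generalized simplex gradient is $\nabla_s f(x;T)=(T^\top)^\dagger\delta_s(x;T)\in\mathbb{R}^n$. For $S=[s^1\cdots s^m]\in\mathbb{R}^{n\times m}$ and $T_{1:m}=\{T_1,\dots,T_m\}$ with $T_i\in\mathbb{R}^{n\times k_i}$, the generalized simplex Hessian (GSH) is $$\nabla_s^2 f(x^0;S,T_{1:m})=(S^\top)^\dagger\,\delta_s^2(x^0;S,T_{1:m})\in\mathbb{R}^{n\times n},$$ where $\delta_s^2(x^0;S,T_{1:m})\in\mathbb{R}^{m\times n}$ has $i$-th row $(\nabla_s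 f(x^0+s^i;T_i)-\nabla_s f(x^0;T_i))^\top$. The generalized centered simplex Hessian (GCSH), defined whenever the two GSHs on the right are, is $$\nabla_c^2 f(x^0;S,T_{1:m})=\tfrac12\left(\nabla_s^2 f(x^0;S,T_{1:m})+\nabla_s^2 f(x^0;-S,-T_{1:m})\right),\qquad -T_{1:m}=\{-T_1,\dots,-T_m\}.$$ If all $T_i$ equal $\overline{T}$ one writes $\nabla_c^2 f(x^0;S,\overline{T})$. For $H\in\mathbb{R}^{n\times n}$, $\operatorname{Proj}_{S,T_{1:m}}H=\sum_{i=1}^m (S^\top)^\dagger e_m^i(e_m^i)^\top S^\top H\,T_iT_i^\dagger$; if all $T_i$ equal $\overline{T}$ this is $\operatorname{Proj}_{S,\overline{T}}H=(S^\top)^\dagger S^\top H\,\overline{T}\,\overline{T}^\dagger$. $\Delta_S=\max_i\|s^i\|$, $\Delta_{T_i}=\max_j\|t_i^j\|$, $\widehat{S}=S/\Delta_S$, $\widehat{T}_i=T_i/\Delta_{T_i}$, $\Delta_u=\max\{\Delta_S,\Delta_{T_1},\dots,\Delta_{T_m}\}$, $\Delta_l=\min\{\Delta_S,\Delta_{T_1},\dots,\Delta_{T_m}\}$, $k=\max\{k_1,\dots,k_m\}$, and $\widehat{T}$ is a $\widehat{T}_i$ for which $\|\widehat{T}_i^\dagger\|$ is maximal over $i\in\{1,\dots,m\}$. *)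

(* Defs.v *)
From mathcomp Require Import all_boot all_order all_algebra.
From mathcomp Require Import all_classical all_reals all_analysis.

Set Implicit Arguments.
Unset Strict Implicit.
Unset Printing Implicit Defensive.

Import Order.TTheory GRing.Theory Num.Theory.
Import numFieldNormedType.Exports.

Local Open Scope classical_set_scope.
Local Open Scope ring_scope.

(** The library norm on ['cV[R]_n] is the max norm; it induces the topology
    used by [differentiable], [interior], ... but is not the norm of the
    estimates, hence [enorm]. *)
Definition enorm (R : realType) (n : nat) (u : 'cV[R]_n) : R :=
  Num.sqrt (\sum_(i < n) u i ord0 ^+ 2).

Definition eball (R : realType) (n : nat) (x : 'cV[R]_n) (r : R) :
  set 'cV[R]_n := [set y | enorm (y - x) < r].

Definition eclosed_ball (R : realType) (n : nat) (x : 'cV[R]_n) (r : R) :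
  set 'cV[R]_n := [set y | enorm (y - x) <= r].

Definition specnorm (R : realType) (p q : nat) (A : 'M[R]_(p, q)) : R :=
  sup [set enorm (A *m u) | u in [set u : 'cV[R]_q | enorm u <= 1]].

(** A trilinear form on [R^n] is given by its coefficients [A i j k]. *)
Definition trilinear_form (R : realType) (n : nat)
    (A : 'I_n -> 'I_n -> 'I_n -> R) (u v w : 'cV[R]_n) : R :=
  \sum_i \sum_j \sum_k A i j k * u i ord0 * v j ord0 * w k ord0.

Definition trilinear_norm (R : realType) (n : nat)
    (A : 'I_n -> 'I_n -> 'I_n -> R) : R :=
  sup [set r | exists u v w : 'cV[R]_n,
         [/\ enorm u <= 1, enorm v <= 1, enorm w <= 1
           & r = `|trilinear_form A u v w|]].

Definition evec (R : realType) (n : nat) (i : 'I_n) : 'cV[R]_n :=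
  delta_mx i ord0.

(** [partials [:: i; j; k] f] is [d_i (d_j (d_k f))]. *)
Definition partials (R : realType) (n : nat) (s : seq 'I_n)
    (f : 'cV[R]_n -> R) : 'cV[R]_n -> R :=
  foldr (fun i (g : 'cV[R]_n -> R) => fun x => 'D_(evec R i) g x) f s.

(** A partial function with domain [domf] is a total [f] together with the set
    [domf]; asking [x] to be interior to [domf] makes the notion depend only on
    the values of [f] on [domf]. *)
Definition times_differentiable_at (R : realType) (n : nat)
    (domf : set 'cV[R]_n) (k : nat) (f : 'cV[R]_n -> R) (x : 'cV[R]_n) : Prop :=
  [/\ interior domf x,
      (\forall y \near x, forall s : seq 'I_n,
         (size s < k.-1)%N -> differentiable (partials s f) y)
    & forall s : seq 'I_n, (size s < k)%N -> differentiable (partials s f) x].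

(** Meant for open [U]. *)
Definition class_C (R : realType) (n : nat) (domf : set 'cV[R]_n) (k : nat)
    (f : 'cV[R]_n -> R) (U : set 'cV[R]_n) : Prop :=
  forall x, U x -> times_differentiable_at domf k f x /\
    forall s : seq 'I_n, size s = k -> {for x, continuous (partials s f)}.

Definition hessian (R : realType) (n : nat) (f : 'cV[R]_n -> R)
    (x : 'cV[R]_n) : 'M[R]_n := \matrix_(i, j) partials [:: i; j] f x.

Definition third_derivative (R : realType) (n : nat) (f : 'cV[R]_n -> R)
    (x : 'cV[R]_n) (i j k : 'I_n) : R := partials [:: i; j; k] f x.

(** The first conjunct says that the third derivative exists on [A]. *)
Definition third_derivative_lipschitz (R : realType) (n : nat)
    (domf : set 'cV[R]_n) (f : 'cV[R]_n -> R) (L : R)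
    (A : set 'cV[R]_n) : Prop :=
  (forall x, A x -> times_differentiable_at domf 3 f x) /\
  (forall x y, A x -> A y ->
     trilinear_norm (fun i j k =>
       third_derivative f x i j k - third_derivative f y i j k)
     <= L * enorm (x - y)).

Definition penrose (R : realType) (p q : nat) (A : 'M[R]_(p, q))
    (X : 'M[R]_(q, p)) : Prop :=
  [/\ A *m X *m A = A, X *m A *m X = X,
      (A *m X)^T = A *m X & (X *m A)^T = X *m A].

Definition mp_inverse (R : realType) (p q : nat) (A : 'M[R]_(p, q)) : 'M[R]_(q, p) :=
  xget 0 [set X | penrose A X].

Lemma penrose_unique (R : realType) (p q : nat) (A : 'M[R]_(p, q))
  (X Y : 'M[R]_(q, p)) : penrose A X -> penrose A Y -> X = Y.
Proof.
move=> [x1 x2 x3 x4] [y1 y2 y3 y4].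
have eA : A *m X = A *m Y.
  have -> : A *m X = (A *m Y *m (A *m X))^T by rewrite mulmxA y1 x3.
  by rewrite trmx_mul x3 y3 mulmxA x1.
have eB : X *m A = Y *m A.
  have -> : X *m A = (X *m A *m (Y *m A))^T.
    by rewrite -(mulmxA X) (mulmxA A Y) y1 x4.
  by rewrite trmx_mul x4 y4 -(mulmxA Y) (mulmxA A X) x1.
by rewrite -x2 -mulmxA eA mulmxA eB y2.
Qed.

Lemma row_free_gram_unit (R : realType) (p q : nat) (B : 'M[R]_(p, q)) :
  row_free B -> B *m B^T \in unitmx.
Proof.
move=> fB; rewrite -row_free_unit -kermx_eq0; apply/rowV0P => u.
move=> /sub_kermxP; rewrite mulmxA => h.
have uB0 : u *m B = 0.
  have : (u *m B) *m (u *m B)^T = 0 by rewrite trmx_mul mulmxA h mul0mx.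
  move=> /(congr1 (fun M : 'M[R]_1 => M ord0 ord0)); rewrite !mxE => /eqP.
  rewrite psumr_eq0; last by move=> j _; rewrite [X in _ * X]mxE -expr2 sqr_ge0.
  move=> /allP h0; apply/rowP => j; rewrite [RHS]mxE; apply/eqP.
  by have := h0 j (mem_index_enum _); rewrite [X in _ * X]mxE -expr2 sqrf_eq0.
by apply: (row_free_inj fB); rewrite uB0 mul0mx.
Qed.

Lemma penrose_exists (R : realType) (p q : nat) (A : 'M[R]_(p, q)) :
  exists X, penrose A X.
Proof.
have [r [C [B [eA fC fB]]]] : exists r (C : 'M[R]_(p, r)) (B : 'M[R]_(r, q)),
    [/\ A = C *m B, row_free C^T & row_free B].
  exists (\rank A), (col_base A), (row_base A); split.
  - by rewrite mulmx_base.
  - by rewrite /row_free mxrank_tr -/(row_full _) col_base_full.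
  - exact: row_base_free.
have uB : B *m B^T \in unitmx by exact: row_free_gram_unit.
have uC : C^T *m C \in unitmx.
  by rewrite -[X in _ *m X]trmxK; exact: row_free_gram_unit.
set X := B^T *m invmx (B *m B^T) *m (invmx (C^T *m C) *m C^T).
have AX : A *m X = C *m invmx (C^T *m C) *m C^T.
  by rewrite eA /X !mulmxA -(mulmxA C B) -(mulmxA C (B *m B^T)) mulmxV // mulmx1.
have XA : X *m A = B^T *m invmx (B *m B^T) *m B.
  rewrite eA /X -!mulmxA; congr (_ *m (_ *m _)).
  by rewrite (mulmxA C^T) mulmxA mulVmx // mul1mx.
exists X; split.
- rewrite AX eA -!mulmxA; congr (_ *m _).
  by rewrite (mulmxA C^T) mulmxA mulVmx // mul1mx.
- rewrite XA /X !mulmxA -(mulmxA _ B B^T) -(mulmxA _ (B *m B^T)) mulmxV //.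
  by rewrite mulmx1.
- by rewrite AX !trmx_mul trmx_inv trmx_mul !trmxK mulmxA.
- by rewrite XA !trmx_mul trmx_inv trmx_mul !trmxK mulmxA.
Qed.

Lemma mp_inverseP (R : realType) (p q : nat) (A : 'M[R]_(p, q)) : penrose A (mp_inverse A).
Proof.
have [X AX] := penrose_exists A.
exact: (@xgetPex _ 0 [set X | penrose A X] (ex_intro _ X AX)).
Qed.

(** In the definitions below the family [T_1, ..., T_m], with [T_i] of size [n x k_i], is a dependent
    function [T : forall i : 'I_m, 'M[R]_(n, k_ i)]. *)

Definition simplex_gradient (R : realType) (n k : nat) (f : 'cV[R]_n -> R)
    (x : 'cV[R]_n) (T : 'M[R]_(n, k)) : 'cV[R]_n :=
  mp_inverse T^T *m \col_(j < k) (f (x + col j T) - f x).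

Definition GSH (R : realType) (n m : nat) (k_ : 'I_m -> nat)
    (f : 'cV[R]_n -> R) (x0 : 'cV[R]_n) (S : 'M[R]_(n, m))
    (T : forall i : 'I_m, 'M[R]_(n, k_ i)) : 'M[R]_n :=
  mp_inverse S^T *m
  \matrix_(i < m) (simplex_gradient f (x0 + col i S) (T i)
                   - simplex_gradient f x0 (T i))^T.

Definition GCSH (R : realType) (n m : nat) (k_ : 'I_m -> nat)
    (f : 'cV[R]_n -> R) (x0 : 'cV[R]_n) (S : 'M[R]_(n, m))
    (T : forall i : 'I_m, 'M[R]_(n, k_ i)) : 'M[R]_n :=
  2^-1 *: (GSH f x0 S T + GSH f x0 (- S) (fun i => - T i)).

Definition Proj (R : realType) (n m : nat) (k_ : 'I_m -> nat)
    (S : 'M[R]_(n, m)) (T : forall i : 'I_m, 'M[R]_(n, k_ i))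
    (H : 'M[R]_n) : 'M[R]_n :=
  \sum_(i < m) mp_inverse S^T *m evec R i *m (evec R i)^T *m S^T *m H
               *m T i *m mp_inverse (T i).

Lemma Proj_const (R : realType) (n m k : nat) (S : 'M[R]_(n, m))
  (Tbar : 'M[R]_(n, k)) (H : 'M[R]_n) :
  Proj S (fun=> Tbar) H = mp_inverse S^T *m S^T *m H *m Tbar *m mp_inverse Tbar.
Proof.
rewrite /Proj -!mulmx_suml; do 4!congr (_ *m _).
under eq_bigr do rewrite -mulmxA.
rewrite -mulmx_sumr -[RHS]mulmx1; congr (_ *m _).
apply/matrixP => a b; rewrite summxE (bigD1 a) //= big1 => [|i ia].
  by rewrite addr0 /evec trmx_delta mul_delta_mx !mxE eqxx eq_sym.
by rewrite /evec trmx_delta mul_delta_mx !mxE eq_sym (negPf ia).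
Qed.

Definition col_radius (R : realType) (n k : nat) (A : 'M[R]_(n, k)) : R :=
  \big[Num.max/0]_(j < k) enorm (col j A).

Definition normalized (R : realType) (n k : nat) (A : 'M[R]_(n, k)) :
  'M[R]_(n, k) := (col_radius A)^-1 *: A.

Definition radius_u (R : realType) (n m : nat) (k_ : 'I_m -> nat)
    (S : 'M[R]_(n, m)) (T : forall i : 'I_m, 'M[R]_(n, k_ i)) : R :=
  \big[Num.max/col_radius S]_(i < m) col_radius (T i).

Definition radius_l (R : realType) (n m : nat) (k_ : 'I_m -> nat)
    (S : 'M[R]_(n, m)) (T : forall i : 'I_m, 'M[R]_(n, k_ i)) : R :=
  \big[Num.min/col_radius S]_(i < m) col_radius (T i).

Definition admissible (R : realType) (n m : nat) (k_ : 'I_m -> nat)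
    (x0 : 'cV[R]_n) (Delta : R) (S : 'M[R]_(n, m))
    (T : forall i : 'I_m, 'M[R]_(n, k_ i)) : Prop :=
  [/\ S != 0, (forall i, T i != 0)
    & forall i,
        eclosed_ball (x0 + col i S) (col_radius (T i)) `<=` eball x0 Delta /\
        eclosed_ball (x0 - col i S) (col_radius (T i)) `<=` eball x0 Delta].

(* Main.v *)
Require Import Defs.
From mathcomp Require Import all_boot all_order all_algebra.
From mathcomp Require Import all_classical all_reals all_analysis.
From mathcomp Require Import ring lra.

Import Order.TTheory GRing.Theory Num.Theory.
Import numFieldNormedType.Exports.

Local Open Scope classical_set_scope.
Local Open Scope ring_scope.

Set Implicit Arguments.
Unset Strict Implicit.

(** Both [GCSH] and [Proj S T (hessian f x0)] are [(S^T)^+] times a matrix whose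
    [i]-th row is a row vector times [(T i)^+].  The difference of these row
    vectors has as [j]-th entry half the mixed second difference of
    [Psi u = f (x0 + u) + f (x0 - u)] along [s] and [t], minus [s^T H t], where
    [s = col i S], [t = col j (T i)] and [H = hessian f x0].  Two applications
    of the mean value theorem turn the second difference into [D_s D_t Psi u]
    with [u = a s + b t], [0 <= a, b <= 1].  As [Psi] is even, the cubic terms cancel
    and the Lipschitz bound gives
    [|D_s D_t Psi u - 2 s^T H t| <= L |u|^2 |s| |t| <= 4 L Delta_u^4].
    In (i), [1 / (Delta_S Delta_{T_i}) <= 1 / Delta_l^2]; in (ii) there are only
    two radii, so [Delta_S Delta_T = Delta_u Delta_l]. *)

(** * Euclidean, spectral and trilinear norms *)

Definition dotp (R : realType) (n : nat) (u v : 'cV[R]_n) : R :=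
  \sum_i u i ord0 * v i ord0.

Lemma dotpNl (R : realType) (n : nat) (u v : 'cV[R]_n) :
  dotp (- u) v = - dotp u v.
Proof. by rewrite -sumrN; apply: eq_bigr => i _; rewrite mxE mulNr. Qed.

Lemma dotp_trmx (R : realType) (p q : nat) (A : 'M[R]_(p, q))
  (u : 'cV[R]_p) (v : 'cV[R]_q) : dotp (A^T *m u) v = dotp u (A *m v).
Proof.
rewrite /dotp; under eq_bigr do rewrite mxE mulr_suml.
rewrite exchange_big; apply: eq_bigr => i _ /=; rewrite mxE mulr_sumr.
by apply: eq_bigr => j _; rewrite mxE mulrCA mulrA.
Qed.

Lemma enorm_ge0 (R : realType) (n : nat) (u : 'cV[R]_n) : 0 <= enorm u.
Proof. exact: sqrtr_ge0. Qed.

Lemma sqr_enorm (R : realType) (n : nat) (u : 'cV[R]_n) :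
  enorm u ^+ 2 = dotp u u.
Proof.
by rewrite sqr_sqrtr ?sumr_ge0 // => i _; rewrite sqr_ge0.
Qed.

Lemma enorm_coord (R : realType) (n : nat) (u : 'cV[R]_n) i :
  `|u i ord0| <= enorm u.
Proof.
rewrite -sqrtr_sqr ler_wsqrtr // (bigD1 i) //= lerDl sumr_ge0 // => j _.
exact: sqr_ge0.
Qed.

Lemma enorm_eq0 (R : realType) (n : nat) (u : 'cV[R]_n) :
  enorm u = 0 -> u = 0.
Proof.
move=> u0; apply/colP => i; rewrite mxE; apply/eqP.
by rewrite -normr_le0 -u0 enorm_coord.
Qed.

Lemma enorm0 (R : realType) (n : nat) : enorm (0 : 'cV[R]_n) = 0.
Proof.
by rewrite /enorm big1 ?sqrtr0 // => i _; rewrite mxE expr0n.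
Qed.

Lemma enormZ (R : realType) (n : nat) (c : R) (u : 'cV[R]_n) :
  enorm (c *: u) = `|c| * enorm u.
Proof.
rewrite -sqrtr_sqr -sqrtrM ?sqr_ge0 // mulr_sumr; congr Num.sqrt.
by apply: eq_bigr => i _; rewrite mxE exprMn.
Qed.

Lemma enormN (R : realType) (n : nat) (u : 'cV[R]_n) : enorm (- u) = enorm u.
Proof. by rewrite -scaleN1r enormZ normrN1 mul1r. Qed.

(** Expanding the sum of squares of [|v| u_i - |u| v_i] gives [2 |u| |v| (|u| |v| - u.v) >= 0]. Zero
    vectors are set apart so that [|u| |v|] can be cancelled. *)
Lemma dotp_le (R : realType) (n : nat) (u v : 'cV[R]_n) :
  dotp u v <= enorm u * enorm v.
Proof.
have [u0|u0] := eqVneq (enorm u) 0.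
  rewrite u0 mul0r (enorm_eq0 u0) /dotp big1 // => i _.
  by rewrite mxE mul0r.
have [v0|v0] := eqVneq (enorm v) 0.
  rewrite v0 mulr0 (enorm_eq0 v0) /dotp big1 // => i _.
  by rewrite mxE mulr0.
have uv_gt0 : 0 < enorm u * enorm v.
  by rewrite mulr_gt0 // lt_neqAle eq_sym ?u0 ?v0 enorm_ge0.
rewrite -(ler_pM2l uv_gt0) -subr_ge0 -(@pmulr_rge0 _ 2) //.
set a := enorm u in uv_gt0 *; set b := enorm v in uv_gt0 *.
suff -> : 2 * (a * b * (a * b) - a * b * dotp u v)
    = \sum_i (b * u i ord0 - a * v i ord0) ^+ 2.
  by apply: sumr_ge0 => i _; exact: sqr_ge0.
have -> : \sum_i (b * u i ord0 - a * v i ord0) ^+ 2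
    = b ^+ 2 * dotp u u + a ^+ 2 * dotp v v - 2 * a * b * dotp u v.
  rewrite /dotp !mulr_sumr -big_split /= -sumrB; apply: eq_bigr => i _; ring.
rewrite -!sqr_enorm -/a -/b; ring.
Qed.

Lemma CauchySchwarz_enorm (R : realType) (n : nat) (u v : 'cV[R]_n) :
  `|dotp u v| <= enorm u * enorm v.
Proof.
by rewrite ler_norml lerNl -dotpNl -{1}(enormN u) !dotp_le.
Qed.

Lemma enormD (R : realType) (n : nat) (u v : 'cV[R]_n) :
  enorm (u + v) <= enorm u + enorm v.
Proof.
rewrite -(@ler_pXn2r _ 2) ?nnegrE ?addr_ge0 ?enorm_ge0 //.
rewrite sqrrD !sqr_enorm.
have -> : dotp (u + v) (u + v) = dotp u u + dotp u v *+ 2 + dotp v v.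
  rewrite /dotp -sumrMnl -!big_split; apply: eq_bigr => i _ /=; rewrite mxE.
  ring.
by rewrite lerD2r lerD2l lerMn2r dotp_le.
Qed.

(** Passing from a bound on the coordinates to the Euclidean norm is where the factors [sqrt m] and
    [sqrt k] of the estimates come from. *)
Lemma enorm_col_le (R : realType) (n : nat) (u : 'cV[R]_n) (c : R) :
  0 <= c -> (forall i, `|u i ord0| <= c) -> enorm u <= Num.sqrt n%:R * c.
Proof.
move=> c0 uc; rewrite -(ger0_norm c0) -sqrtr_sqr -sqrtrM // ler_wsqrtr //.
rewrite -mulr_natl mulr1 -[X in X%:R * _](card_ord n) mulr_natl -sumr_const.
apply: ler_sum => i _; rewrite -(real_normK (num_real _)).
by rewrite ler_pXn2r ?nnegrE.
Qed.

Lemma mulmx_rows_le (R : realType) (p q : nat) (A : 'M[R]_(p, q)) (c : R) :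
  0 <= c -> (forall i, enorm (row i A)^T <= c) ->
  forall u, enorm (A *m u) <= Num.sqrt p%:R * c * enorm u.
Proof.
move=> c0 Ac u; rewrite -mulrA; apply: enorm_col_le.
  by rewrite mulr_ge0 ?enorm_ge0.
move=> i; have -> : (A *m u) i ord0 = dotp (row i A)^T u.
  by rewrite mxE; apply: eq_bigr => j _; rewrite !mxE.
apply: le_trans (CauchySchwarz_enorm _ _) _.
by rewrite ler_wpM2r ?enorm_ge0.
Qed.

(** This makes the supremum in [specnorm] genuine rather than a default value. The sum of all row
    norms serves as a crude common bound for the rows. *)
Lemma specnorm_ubound (R : realType) (p q : nat) (A : 'M[R]_(p, q)) :
  has_sup [set enorm (A *m u) | u in [set u : 'cV[R]_q | enorm u <= 1]].
Proof.
split; first by exists (enorm (A *m 0)), 0 => //=; rewrite enorm0 ler01.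
pose c := \sum_i enorm (row i A)^T.
have c0 : 0 <= c by apply: sumr_ge0 => i _; exact: enorm_ge0.
exists (Num.sqrt p%:R * c) => _ [u /= u1 <-].
apply: le_trans (mulmx_rows_le (c := c) _ _ u) _ => //.
  move=> i; rewrite /c (bigD1 i) //= lerDl sumr_ge0 // => j _.
  exact: enorm_ge0.
by rewrite ler_piMr // mulr_ge0 // sqrtr_ge0.
Qed.

Lemma specnorm_ge0 (R : realType) (p q : nat) (A : 'M[R]_(p, q)) :
  0 <= specnorm A.
Proof.
apply: (@le_trans _ _ (enorm (A *m 0))); first exact: enorm_ge0.
apply: ub_le_sup; first by case: (specnorm_ubound A).
by exists 0 => //=; rewrite enorm0 ler01.
Qed.

Lemma enorm_mulmx_le (R : realType) (p q : nat) (A : 'M[R]_(p, q)) u :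
  enorm (A *m u) <= specnorm A * enorm u.
Proof.
have [u0|u0] := eqVneq (enorm u) 0.
  by rewrite u0 mulr0 (enorm_eq0 u0) mulmx0 enorm0.
have u_gt0 : 0 < enorm u by rewrite lt_neqAle eq_sym u0 enorm_ge0.
rewrite -ler_pdivrMr //.
have -> : enorm (A *m u) / enorm u = enorm (A *m ((enorm u)^-1 *: u)).
  by rewrite -scalemxAr enormZ ger0_norm ?invr_ge0 ?enorm_ge0 // mulrC.
apply: ub_le_sup; first by case: (specnorm_ubound A).
exists ((enorm u)^-1 *: u) => //=.
by rewrite enormZ ger0_norm ?invr_ge0 ?enorm_ge0 // mulVf.
Qed.

Lemma specnorm_le (R : realType) (p q : nat) (A : 'M[R]_(p, q)) (c : R) :
  0 <= c -> (forall u, enorm (A *m u) <= c * enorm u) -> specnorm A <= c.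
Proof.
move=> c0 Ac; apply: ge_sup; first by case: (specnorm_ubound A).
by move=> _ [u /= u1 <-]; apply: le_trans (Ac u) _; rewrite ler_piMr.
Qed.

Lemma specnormM (R : realType) (p q r : nat) (A : 'M[R]_(p, q))
  (B : 'M[R]_(q, r)) : specnorm (A *m B) <= specnorm A * specnorm B.
Proof.
apply: specnorm_le => [|u]; first by rewrite mulr_ge0 ?specnorm_ge0.
rewrite -mulmxA -mulrA; apply: le_trans (enorm_mulmx_le _ _) _.
by rewrite ler_wpM2l ?specnorm_ge0 // enorm_mulmx_le.
Qed.

Lemma specnormZ (R : realType) (p q : nat) (c : R) (A : 'M[R]_(p, q)) :
  specnorm (c *: A) <= `|c| * specnorm A.
Proof.
apply: specnorm_le => [|u]; first by rewrite mulr_ge0 ?specnorm_ge0.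
by rewrite -scalemxAl enormZ -mulrA ler_wpM2l // enorm_mulmx_le.
Qed.

(** Cancel [|A^T u|] in [|A^T u|^2 = u.(A A^T u) <= |u| |A| |A^T u|]. *)
Lemma specnorm_trmx (R : realType) (p q : nat) (A : 'M[R]_(p, q)) :
  specnorm A^T <= specnorm A.
Proof.
apply: specnorm_le => [|u]; first exact: specnorm_ge0.
have [e0|e0] := eqVneq (enorm (A^T *m u)) 0.
  by rewrite e0 mulr_ge0 ?specnorm_ge0 ?enorm_ge0.
have e_gt0 : 0 < enorm (A^T *m u) by rewrite lt_neqAle eq_sym e0 enorm_ge0.
rewrite -(ler_pM2r e_gt0) -expr2 sqr_enorm dotp_trmx.
apply: le_trans (dotp_le _ _) _; rewrite mulrAC mulrC.
by rewrite ler_wpM2r ?enorm_ge0 // enorm_mulmx_le.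
Qed.

Lemma specnorm_rows_le (R : realType) (p q : nat) (A : 'M[R]_(p, q)) (c : R) :
  0 <= c -> (forall i, enorm (row i A)^T <= c) ->
  specnorm A <= Num.sqrt p%:R * c.
Proof.
move=> c0 Ac; apply: specnorm_le; last exact: mulmx_rows_le.
by rewrite mulr_ge0 // sqrtr_ge0.
Qed.

Lemma trilinear_formZ (R : realType) (n : nat) (A : 'I_n -> 'I_n -> 'I_n -> R)
  (a b c : R) (u v w : 'cV[R]_n) :
  trilinear_form A (a *: u) (b *: v) (c *: w)
  = a * b * c * trilinear_form A u v w.
Proof.
rewrite /trilinear_form mulr_sumr; apply: eq_bigr => i _.
rewrite mulr_sumr; apply: eq_bigr => j _.
rewrite mulr_sumr; apply: eq_bigr => k _; rewrite !mxE; ring.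
Qed.

Lemma trilinear_norm_ubound (R : realType) (n : nat)
  (A : 'I_n -> 'I_n -> 'I_n -> R) :
  has_ubound [set r | exists u v w : 'cV[R]_n,
    [/\ enorm u <= 1, enorm v <= 1, enorm w <= 1
      & r = `|trilinear_form A u v w|]].
Proof.
exists (\sum_i \sum_j \sum_k `|A i j k|) => _ [u [v [w [u1 v1 w1 ->]]]].
have coord1 (z : 'cV[R]_n) i : enorm z <= 1 -> `|z i ord0| <= 1.
  by move=> z1; apply: le_trans z1; exact: enorm_coord.
apply: le_trans (ler_norm_sum _ _ _) _; apply: ler_sum => i _.
apply: le_trans (ler_norm_sum _ _ _) _; apply: ler_sum => j _.
apply: le_trans (ler_norm_sum _ _ _) _; apply: ler_sum => k _.
rewrite !normrM -!mulrA ler_piMr //.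
by rewrite mulr_ile1 ?mulr_ge0 ?mulr_ile1 ?coord1.
Qed.

Lemma trilinear_norm_ge0 (R : realType) (n : nat)
  (A : 'I_n -> 'I_n -> 'I_n -> R) : 0 <= trilinear_norm A.
Proof.
apply: (@le_trans _ _ `|trilinear_form A 0 0 0|) => //.
apply: ub_le_sup; first exact: trilinear_norm_ubound.
by exists 0, 0, 0; rewrite enorm0 ler01.
Qed.

(** Homogeneity in each argument reduces the bound to vectors of norm at most 1; the zero vector is
    its norm times 0, so only nonzero vectors are divided by their norm. *)
Lemma trilinear_form_le (R : realType) (n : nat)
  (A : 'I_n -> 'I_n -> 'I_n -> R) (u v w : 'cV[R]_n) :
  `|trilinear_form A u v w|
  <= trilinear_norm A * (enorm u * enorm v * enorm w).
Proof.
have unitize (z : 'cV[R]_n) :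
    exists2 z', enorm z' <= 1 & z = enorm z *: z'.
  have [z0|z0] := eqVneq (enorm z) 0.
    by exists 0; rewrite ?enorm0 // z0 scale0r; exact: enorm_eq0.
  exists ((enorm z)^-1 *: z); last by rewrite scalerA divff // scale1r.
  by rewrite enormZ ger0_norm ?invr_ge0 ?enorm_ge0 // mulVf.
have [u' u1 eu] := unitize u; have [v' v1 ev] := unitize v.
have [w' w1 ew] := unitize w.
rewrite {1}eu {1}ev {1}ew trilinear_formZ normrM mulrC.
rewrite (ger0_norm (x := _ * _ * _)) ?mulr_ge0 ?enorm_ge0 //.
rewrite ler_wpM2r ?mulr_ge0 ?enorm_ge0 //.
apply: ub_le_sup; first exact: trilinear_norm_ubound.
by exists u', v', w'.
Qed.

(** * Rules for the Moore-Penrose inverse *)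

Lemma mp_inverse_eq (R : realType) (p q : nat) (A : 'M[R]_(p, q)) X :
  penrose A X -> mp_inverse A = X.
Proof. exact: penrose_unique (mp_inverseP A). Qed.

(** Transposition permutes the four Penrose equations, so uniqueness identifies the two sides. *)
Lemma mp_inverse_trmx (R : realType) (p q : nat) (A : 'M[R]_(p, q)) :
  mp_inverse A^T = (mp_inverse A)^T.
Proof.
have [h1 h2 h3 h4] := mp_inverseP A; apply: mp_inverse_eq.
by split; rewrite -!trmx_mul ?mulmxA ?h1 ?h2 ?h3 ?h4.
Qed.

Lemma penroseZ (R : realType) (p q : nat) (c : R) (A : 'M[R]_(p, q)) X :
  c != 0 -> penrose A X -> penrose (c *: A) (c^-1 *: X).
Proof.
move=> c0 [h1 h2 h3 h4].
have AX : (c *: A) *m (c^-1 *: X) = A *m X.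
  by rewrite -scalemxAl -scalemxAr scalerA mulfV // scale1r.
have XA : (c^-1 *: X) *m (c *: A) = X *m A.
  by rewrite -scalemxAl -scalemxAr scalerA mulVf // scale1r.
by split; rewrite ?AX ?XA // -scalemxAr ?h1 ?h2.
Qed.

Lemma mp_inverseZ (R : realType) (p q : nat) (c : R) (A : 'M[R]_(p, q)) :
  c != 0 -> mp_inverse (c *: A) = c^-1 *: mp_inverse A.
Proof.
by move=> c0; apply/mp_inverse_eq/penroseZ => //; exact: mp_inverseP.
Qed.

Lemma mp_inverseN (R : realType) (p q : nat) (A : 'M[R]_(p, q)) :
  mp_inverse (- A) = - mp_inverse A.
Proof.
by rewrite -scaleN1r mp_inverseZ ?oppr_eq0 ?oner_eq0 // invrN1 scaleN1r.
Qed.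

Lemma row_free_mp_inverse (R : realType) (p q : nat) (A : 'M[R]_(p, q)) :
  row_free A -> A *m mp_inverse A = 1%:M.
Proof.
move=> fA; apply: (row_free_inj fA).
by rewrite mul1mx; have [] := mp_inverseP A.
Qed.

(** * The second-difference estimate *)

(** Reversing the direction [u] turns a sum of two third derivatives into a difference, which is
    what the Lipschitz condition bounds. *)
Lemma trilinear_formB (R : realType) (n : nat)
  (A B : 'I_n -> 'I_n -> 'I_n -> R) (u v w : 'cV[R]_n) :
  trilinear_form A u v w + trilinear_form B (- u) v w
  = trilinear_form (fun i j k => A i j k - B i j k) u v w.
Proof.
rewrite /trilinear_form -big_split /=; apply: eq_bigr => i _.
rewrite -big_split /=; apply: eq_bigr => j _.
rewrite -big_split /=; apply: eq_bigr => k _; rewrite mxE; ring.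
Qed.

Lemma exchange_lincomb (R : realType) (n : nat) (c d : 'I_n -> R)
  (F : 'I_n -> 'I_n -> R) :
  \sum_j c j * (\sum_i d i * F i j) = \sum_i d i * \sum_j c j * F i j.
Proof.
under eq_bigr do rewrite mulr_sumr.
rewrite exchange_big; apply: eq_bigr => i _; rewrite mulr_sumr.
by apply: eq_bigr => j _; rewrite mulrCA.
Qed.

(** * Derivatives along lines and mean value bounds *)

Lemma is_derive_lincomb (R : realType) (n : nat) (c : 'I_n -> R)
  (g : 'I_n -> R -> R) (dg : 'I_n -> R) (x : R) :
  (forall i, is_derive x 1 (g i) (dg i)) ->
  is_derive x 1 (fun y => \sum_i c i * g i y) (\sum_i c i * dg i).
Proof.
move=> dgP; have -> : (fun y => \sum_i c i * g i y) = \sum_i (c i \*: g i).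
  by apply/funext => y; rewrite fct_sumE.
by apply: is_derive_sum => i; exact: is_deriveZ.
Qed.

(** The difference quotient of the restriction at [a] is that of [g] at [x + a *: u] along [u], and
    differentiability makes the directional derivative linear in [u]. *)
Lemma is_derive_line (R : realType) (n : nat) (g : 'cV[R]_n -> R)
  (x u : 'cV[R]_n) (a : R) :
  differentiable g (x + a *: u) ->
  is_derive a 1 (fun b => g (x + b *: u))
    (\sum_i u i ord0 * 'D_(evec R i) g (x + a *: u)).
Proof.
move=> dg; set y := x + a *: u.
have quotientE : (fun h : R => h^-1 *: (((fun b => g (x + b *: u)) \o shift a)
      (h *: (1 : R)) - g y))
    = (fun h : R => h^-1 *: ((g \o shift y) (h *: u) - g y)).
  apply/funext => h /=; congr (_ *: (g _ - _)).
  by rewrite /y scalerDl [h *: 1]mulr1 addrCA.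
have -> : \sum_i u i ord0 * 'D_(evec R i) g y = 'D_u g y.
  rewrite deriveE //.
have {2}-> : u = \sum_i u i ord0 *: evec R i.
  rewrite {1}[u]matrix_sum_delta; apply: eq_bigr => i _.
  by rewrite big_ord1.
by rewrite linear_sum; apply: eq_bigr => i _; rewrite linearZ /= deriveE.
apply: DeriveDef; last by rewrite /derive quotientE.
by rewrite /derivable quotientE; exact: diff_derivable.
Qed.

Lemma MVT_unit (R : realType) (g dg : R -> R) :
  (forall a : R, 0 <= a <= 1 -> is_derive a 1 g (dg a)) ->
  exists2 c, 0 <= c <= 1 & g 1 - g 0 = dg c.
Proof.
move=> dgP; have [||c c01 gE] := @MVT_segment R g dg 0 1 ler01.
- by move=> x /[!in_itv] /= /andP[x0 x1]; apply: dgP; rewrite !ltW.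
- apply: derivable_within_continuous => x /[!in_itv] /= /dgP.
  by case.
- by exists c; [rewrite in_itv in c01 | rewrite gE subr0 mulr1].
Qed.

(** The mean value theorem is applied to [h - C a^2] with [h = g] and [h = - g]. Applied to [g]
    alone it would only give the constant [2 C]. *)
Lemma increment_quadratic_le (R : realType) (g dg : R -> R) (C : R) :
  (forall a : R, 0 <= a <= 1 -> is_derive a 1 g (dg a)) ->
  (forall a : R, 0 <= a <= 1 -> `|dg a| <= 2 * C * a) ->
  `|g 1 - g 0| <= C.
Proof.
move=> dgP dg_le.
have square (a : R) : is_derive a 1 (fun b : R => C * b ^+ 2) (2 * C * a).
  apply: (is_derive_eq (is_deriveZ C (is_deriveX 2 (is_derive_id a 1)))).
  by rewrite /GRing.scale /=; ring.
have above (h dh : R -> R) :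
    (forall a : R, 0 <= a <= 1 -> is_derive a 1 h (dh a)) ->
    (forall a : R, 0 <= a <= 1 -> dh a <= 2 * C * a) -> h 1 - h 0 <= C.
  move=> dhP dh_le.
  have [|c c01] := @MVT_unit R (fun a => h a - C * a ^+ 2)
    (fun a => dh a - 2 * C * a).
    by move=> a a01; have dh_a := dhP a a01; exact: is_deriveB.
  have := dh_le c c01; rewrite expr0n expr1n /=; lra.
rewrite ler_norml lerNl; apply/andP; split; last first.
  by apply: above dgP _ => a /dg_le; apply: le_trans; exact: ler_norm.
have -> : - (g 1 - g 0) = (- g) 1 - (- g) 0 by rewrite !fctE; ring.
apply: (above _ (fun a => - dg a)) => a a01.
  by apply: is_deriveN; exact: dgP.
by apply: le_trans (dg_le _ a01); rewrite -normrN ler_norm.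
Qed.

(** For [a <= b] the vector is [a (s + t) + (b - a) t], whose nonnegative weights add up to
    [b <= 1]; the other case is symmetric. This keeps the intermediate points of the mean value
    theorems in the ball. *)
Lemma enorm_comb_lt (R : realType) (n : nat) (s t : 'cV[R]_n) (a b d : R) :
  enorm s < d -> enorm t < d -> enorm (s + t) < d ->
  0 <= a <= 1 -> 0 <= b <= 1 -> enorm (a *: s + b *: t) < d.
Proof.
wlog ab : s t a b / a <= b => [wlg sd td std a01 b01|].
  have [ab|/ltW ba] := leP a b; first exact: wlg.
  by rewrite addrC; apply: wlg => //; rewrite addrC.
move=> sd td std /andP[a0 a1] /andP[b0 b1].
have -> : a *: s + b *: t = a *: (s + t) + (b - a) *: t.
  by rewrite scalerDr scalerBl -addrA [a *: t + _]addrC subrK.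
apply: le_lt_trans (enormD _ _) _; rewrite !enormZ !ger0_norm ?subr_ge0 //.
set M := Num.max (enorm (s + t)) (enorm t).
have Md : M < d by rewrite gt_max std td.
have M0 : 0 <= M by rewrite le_max enorm_ge0.
apply: le_lt_trans Md; apply: (@le_trans _ _ (a * M + (b - a) * M)).
  by rewrite lerD // ler_wpM2l ?subr_ge0 // le_max lexx ?orbT.
by rewrite -mulrDl addrC subrK ler_piMl.
Qed.

(** The index supplies a unit vector, hence a point at distance [d] from [x0]; for this pair of
    points the Lipschitz bound forces [0 <= L * d]. *)
Lemma lipschitz_ge0 (R : realType) (n : nat) (domf : set 'cV[R]_n)
  (f : 'cV[R]_n -> R) (x0 : 'cV[R]_n) (d L : R) (i : 'I_n) :
  0 < d -> third_derivative_lipschitz domf f L (eclosed_ball x0 d) -> 0 <= L.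
Proof.
move=> d0 [_ lipf].
have e1 : enorm (evec R i) = 1.
  rewrite /enorm (bigD1 i) //= big1 => [|j ji]; last first.
    by rewrite mxE (negPf ji) expr0n.
  by rewrite mxE !eqxx expr1n addr0 sqrtr1.
have := lipf (x0 + d *: evec R i) x0.
rewrite /eclosed_ball /= subrr enorm0 addrAC subrr add0r enormZ e1 mulr1.
rewrite gtr0_norm // lexx ltW // => /(_ isT isT).
move=> /(le_trans (trilinear_norm_ge0 _)).
by rewrite pmulr_lge0.
Qed.

(** * First and mixed derivatives, and the even part of [f] *)

Definition first_derivative (R : realType) (n : nat) (f : 'cV[R]_n -> R)
    (t x : 'cV[R]_n) : R :=
  \sum_j t j ord0 * partials [:: j] f x.

Lemma first_derivativeN (R : realType) (n : nat) (f : 'cV[R]_n -> R)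
    (t x : 'cV[R]_n) :
  first_derivative f (- t) x = - first_derivative f t x.
Proof. by rewrite -sumrN; apply: eq_bigr => i _; rewrite mxE mulNr. Qed.

(** This is [D_s (D_t f)], with [s] the outer direction as in [partials [:: i; j]]. In coordinates
    it is linear in [s] and [t] for any [f], and at [x0] it is literally [s^T H t]. *)
Definition mixed_derivative (R : realType) (n : nat) (f : 'cV[R]_n -> R)
    (s t x : 'cV[R]_n) : R :=
  \sum_i s i ord0 * \sum_j t j ord0 * partials [:: i; j] f x.

Lemma mixed_derivativeN (R : realType) (n : nat) (f : 'cV[R]_n -> R)
    (s t x : 'cV[R]_n) :
  mixed_derivative f (- s) t x = - mixed_derivative f s t x.
Proof. by rewrite -sumrN; apply: eq_bigr => i _; rewrite mxE mulNr. Qed.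

Lemma is_derive_first_derivative (R : realType) (n : nat)
  (f : 'cV[R]_n -> R) (x s t : 'cV[R]_n) (a : R) :
  (forall j, differentiable (partials [:: j] f) (x + a *: s)) ->
  is_derive a 1 (fun b => first_derivative f t (x + b *: s))
    (mixed_derivative f s t (x + a *: s)).
Proof.
move=> df; apply: is_derive_eq.
  by apply: is_derive_lincomb => j; apply: is_derive_line; exact: df.
exact: (exchange_lincomb _ _ (fun i j => partials [:: i; j] f (x + a *: s))).
Qed.

(** The function [g a = D2 (x0 + a u) + D2 (x0 - a u)] starts at [2 D2 x0]. Its derivative is the
    difference of the third derivatives at [x0 + a u] and [x0 - a u], evaluated at [u, s, t]. These
    points are [2 a |u|] apart, so the derivative is at most [2 a L |u|^2 |s| |t|], and the
    quadratic increment bound applies. *)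
Lemma mixed_derivative_even_le (R : realType) (n : nat) (domf : set 'cV[R]_n)
  (f : 'cV[R]_n -> R) (x0 s t u : 'cV[R]_n) (d L : R) :
  class_C domf 4 f (eball x0 d) ->
  third_derivative_lipschitz domf f L (eclosed_ball x0 d) ->
  enorm u < d ->
  `|mixed_derivative f s t (x0 + u) + mixed_derivative f s t (x0 - u)
    - 2 * mixed_derivative f s t x0|
  <= L * enorm u ^+ 2 * enorm s * enorm t.
Proof.
move=> fC4 [_ lipf] ud.
pose D2 := mixed_derivative f s t; rewrite -/D2.
have ball (a : R) : 0 <= a <= 1 -> enorm (a *: u) < d.
  move=> /andP[a0 a1]; rewrite enormZ ger0_norm //; apply: le_lt_trans ud.
  by rewrite ler_piMl ?enorm_ge0.
pose T3 x v := trilinear_form (third_derivative f x) v s t.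
have dD2 (v : 'cV[R]_n) a : enorm (a *: v) < d ->
    is_derive a 1 (fun b => D2 (x0 + b *: v)) (T3 (x0 + a *: v) v).
  move=> vd; have xB : eball x0 d (x0 + a *: v).
    by rewrite /eball /= addrAC subrr add0r.
  have [[_ _ fdiff] _] := fC4 _ xB.
  rewrite /D2 /mixed_derivative; apply: is_derive_eq.
    apply: is_derive_lincomb => i; apply: is_derive_lincomb => j.
    by apply: is_derive_line; exact: fdiff.
  rewrite /T3 /trilinear_form [RHS]exchange_big; apply: eq_bigr => i _ /=.
  rewrite [RHS]exchange_big mulr_sumr; apply: eq_bigr => j _ /=.
  rewrite !mulr_sumr; apply: eq_bigr => k _; rewrite /third_derivative /=; ring.
pose g (a : R) := D2 (x0 + a *: u) + D2 (x0 + a *: - u).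
pose dg (a : R) := T3 (x0 + a *: u) u + T3 (x0 + a *: - u) (- u).
clearbody D2.
have -> : D2 (x0 + u) + D2 (x0 - u) - 2 * D2 x0 = g 1 - g 0.
  by rewrite /g !scale1r !scale0r !addr0; ring.
apply: (@increment_quadratic_le _ g dg) => a a01.
  by apply: is_deriveD; apply: dD2; rewrite ?scalerN ?enormN ball.
have -> : dg a = trilinear_form (fun i j k =>
    third_derivative f (x0 + a *: u) i j k
    - third_derivative f (x0 + a *: - u) i j k) u s t.
  by rewrite -trilinear_formB.
apply: le_trans (trilinear_form_le _ _ _ _) _.
have closed v : enorm v < d -> eclosed_ball x0 d (x0 + v).
  by move=> vd; rewrite /eclosed_ball /= addrAC subrr add0r ltW.
have := lipf (x0 + a *: u) (x0 + a *: - u).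
rewrite scalerN => /(_ (closed _ (ball _ a01)) (closed _ _)).
rewrite enormN => /(_ (ball _ a01)).
have -> : x0 + a *: u - (x0 - a *: u) = (2 * a) *: u.
  by rewrite opprB addrACA addrC addrA subrK -scalerDl -mulr2n mulr_natl.
have [a0 _] := andP a01.
rewrite enormZ ger0_norm ?mulr_ge0 // => tri_le.
have -> : 2 * (L * enorm u ^+ 2 * enorm s * enorm t) * a
    = L * (2 * a * enorm u) * (enorm u * enorm s * enorm t) by ring.
by rewrite ler_wpM2r // !mulr_ge0 ?enorm_ge0.
Qed.

(* Differencing along [t] first and [s] second makes the mixed derivative
   appear as [D_s D_t], so the symmetry of the Hessian is not needed. *)
Lemma second_difference_le (R : realType) (n : nat) (domf : set 'cV[R]_n)
  (f : 'cV[R]_n -> R) (x0 s t : 'cV[R]_n) (d L : R) :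
  0 <= L -> class_C domf 4 f (eball x0 d) ->
  third_derivative_lipschitz domf f L (eclosed_ball x0 d) ->
  enorm s < d -> enorm t < d -> enorm (s + t) < d ->
  `|2^-1 * ((f (x0 + s + t) - f (x0 + s) - f (x0 + t) + f x0)
            + (f (x0 - s - t) - f (x0 - s) - f (x0 - t) + f x0))
    - dotp s (hessian f x0 *m t)|
  <= 2^-1 * (L * (enorm s + enorm t) ^+ 2 * enorm s * enorm t).
Proof.
move=> L0 fC4 lipf sd td std.
have ball (a b : R) : 0 <= a <= 1 -> 0 <= b <= 1 -> enorm (a *: s + b *: t) < d.
  exact: enorm_comb_lt.
have fdiff (w : seq 'I_n) v : (size w < 4)%N -> enorm v < d ->
    differentiable (partials w f) (x0 + v).
  move=> w4 vd; have xB : eball x0 d (x0 + v).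
    by rewrite /eball /= addrAC subrr add0r.
  by have [[_ _ fdiff] _] := fC4 _ xB; exact: fdiff.
have i1 : 0 <= (1 : R) <= 1 by rewrite ler01 lexx.
have i0 : 0 <= (0 : R) <= 1 by rewrite ler01 lexx.
pose D1 := first_derivative f t.
pose D2 := mixed_derivative f s t.
(* [G b] is the increment along [s], starting at [b t], of the even function
   [u |-> f (x0 + u) + f (x0 - u)]. Hence [G 1 - G 0] is the sum of the two second differences. *)
pose G (b : R) := f (x0 + s + b *: t) - f (x0 + b *: t)
  + (f (x0 - s + b *: - t) - f (x0 + b *: - t)).
pose dG (b : R) := D1 (x0 + s + b *: t) - D1 (x0 + b *: t)
  - (D1 (x0 - s - b *: t) - D1 (x0 - b *: t)).
have [b b01|b b01 GE] := @MVT_unit R G dG.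
  have dline (x w v : 'cV[R]_n) : x = x0 + w -> enorm (w + b *: v) < d ->
      is_derive b 1 (fun c => f (x + c *: v))
        (first_derivative f v (x + b *: v)).
    move=> -> wd; apply: is_derive_line; rewrite -addrA.
    exact: (fdiff [::]).
  have -> : dG b = first_derivative f t (x0 + s + b *: t)
      - first_derivative f t (x0 + b *: t)
      + (first_derivative f (- t) (x0 - s + b *: - t)
        - first_derivative f (- t) (x0 + b *: - t)).
    by rewrite !first_derivativeN scalerN /dG -/D1; ring.
  have s_t : enorm (s + b *: t) < d.
    by have := ball 1 b i1 b01; rewrite scale1r.
  have z_t : enorm (0 + b *: t) < d.
    by have := ball 0 b i0 b01; rewrite scale0r.
  have d1 := dline (x0 + s) s t erefl s_t.
  have d2 := dline x0 0 t (esym (addr0 x0)) z_t.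
  rewrite -enormN opprD -scalerN in s_t.
  rewrite -enormN opprD -scalerN oppr0 in z_t.
  have d3 := dline (x0 - s) (- s) (- t) erefl s_t.
  have d4 := dline x0 0 (- t) (esym (addr0 x0)) z_t.
  exact: (is_deriveD (is_deriveB d1 d2) (is_deriveB d3 d4)).
(* With [b] fixed by the first mean value theorem, [K 1 - K 0] is [dG b], so a second one, along
   [s], produces the mixed derivative. *)
pose K (a : R) := D1 (x0 + b *: t + a *: s) - D1 (x0 - b *: t + a *: - s).
pose dK (a : R) := D2 (x0 + b *: t + a *: s) + D2 (x0 - b *: t + a *: - s).
have [a a01|a a01 KE] := @MVT_unit R K dK.
  have -> : dK a = mixed_derivative f s t (x0 + b *: t + a *: s)
      - mixed_derivative f (- s) t (x0 - b *: t + a *: - s).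
    by rewrite mixed_derivativeN opprK.
  apply: is_deriveB; apply: is_derive_first_derivative => j; rewrite -addrA;
    apply: fdiff => //.
  - by rewrite addrC ball.
  - by rewrite scalerN -opprD enormN addrC ball.
set u := a *: s + b *: t.
have ud : enorm u < d by exact: ball.
have D2_le := mixed_derivative_even_le s t fC4 lipf ud.
rewrite -/D2 in D2_le.
have -> : dotp s (hessian f x0 *m t) = D2 x0.
  apply: eq_bigr => i _; rewrite mxE; congr (_ * _); apply: eq_bigr => j _.
  by rewrite mxE mulrC.
clearbody D1 D2.
have GK : G 1 - G 0 = dK a.
  rewrite GE -KE /dG /K !scale1r !scale0r !addr0.
  by rewrite (addrAC x0 (b *: t) s) (addrAC x0 (- (b *: t)) (- s)); ring.
have uE : dK a = D2 (x0 + u) + D2 (x0 - u).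
  rewrite /dK /u; congr (D2 _ + D2 _); first by rewrite -addrA (addrC (b *: t)).
  by rewrite scalerN opprD -addrA (addrC (- (b *: t))).
have -> : 2^-1 * ((f (x0 + s + t) - f (x0 + s) - f (x0 + t) + f x0)
    + (f (x0 - s - t) - f (x0 - s) - f (x0 - t) + f x0)) - D2 x0
    = 2^-1 * (D2 (x0 + u) + D2 (x0 - u) - 2 * D2 x0).
  by rewrite -uE -GK /G !scale1r !scale0r !addr0; field.
rewrite normrM ger0_norm ?invr_ge0 // ler_wpM2l ?invr_ge0 //.
(* Since [a] and [b] lie between 0 and 1, [|u| <= |s| + |t|]. *)
apply: le_trans D2_le _.
rewrite !ler_wpM2r ?enorm_ge0 // ler_wpM2l //.
rewrite ler_pXn2r ?nnegrE ?addr_ge0 ?enorm_ge0 //.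
have [/andP[a0 a1] /andP[b0 b1]] := (a01, b01).
apply: le_trans (enormD _ _) _; rewrite !enormZ !ger0_norm //.
by rewrite lerD // ler_piMl ?enorm_ge0.
Qed.

(** * The simplex Hessian *)

Lemma col_radius_ge (R : realType) (n k : nat) (A : 'M[R]_(n, k)) j :
  enorm (col j A) <= col_radius A.
Proof. exact: le_bigmax. Qed.

Lemma col_radius_gt0 (R : realType) (n k : nat) (A : 'M[R]_(n, k)) :
  A != 0 -> 0 < col_radius A.
Proof.
move=> /matrix0Pn [i [j Aij]]; apply: lt_le_trans (col_radius_ge A j).
rewrite lt_neqAle enorm_ge0 andbT eq_sym; apply: contraNneq Aij => /enorm_eq0.
by move=> /colP /(_ i); rewrite !mxE => ->.
Qed.

(** As [A] is its radius times [normalized A], the reciprocal of the radius comes out of the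
    pseudoinverse. *)
Lemma specnorm_mp_inverse_normalized (R : realType) (n k : nat)
  (A : 'M[R]_(n, k)) : A != 0 ->
  specnorm (mp_inverse A)
  <= specnorm (mp_inverse (normalized A)) / col_radius A.
Proof.
move=> A0; have r0 := col_radius_gt0 A0.
have r1 : col_radius A != 0 by rewrite gt_eqF.
have {1}-> : A = col_radius A *: normalized A.
  by rewrite /normalized scalerA mulfV // scale1r.
rewrite mp_inverseZ //; apply: le_trans (specnormZ _ _) _.
by rewrite ger0_norm ?invr_ge0 ?(ltW r0) // mulrC.
Qed.

Lemma specnorm_mp_inverse_normalized_trmx (R : realType) (n k : nat)
  (A : 'M[R]_(n, k)) : A != 0 ->
  specnorm (mp_inverse A^T)
  <= specnorm (mp_inverse (normalized A)^T) / col_radius A.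
Proof.
move=> A0; have r0 := col_radius_gt0 A0.
have r1 : col_radius A != 0 by rewrite gt_eqF.
have {1}-> : A = col_radius A *: normalized A.
  by rewrite /normalized scalerA mulfV // scale1r.
rewrite linearZ /= mp_inverseZ //; apply: le_trans (specnormZ _ _) _.
by rewrite ger0_norm ?invr_ge0 ?(ltW r0) // mulrC.
Qed.

(** The matrix [e_i e_i^T] keeps the [i]-th row and kills the others, so the sum stacks one row for
    each [i] and shows the factor [(S^T)^+] shared with [GCSH]. *)
Lemma Proj_rows (R : realType) (n m : nat) (k_ : 'I_m -> nat)
  (S : 'M[R]_(n, m)) (T : forall i : 'I_m, 'M[R]_(n, k_ i)) (H : 'M[R]_n) :
  Proj S T H = mp_inverse S^T *m
    \matrix_(i < m) (row i S^T *m H *m T i *m mp_inverse (T i)).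
Proof.
have evec_row (p : nat) (v : 'rV[R]_p) i l :
    row l (evec R i *m v) = (l == i)%:R *: v.
  rewrite row_mul -mul_scalar_mx; congr (_ *m _).
  by apply/matrixP => a b; rewrite !ord1 !mxE eqxx andbT mulr1n.
rewrite /Proj; under eq_bigr do rewrite -!mulmxA.
rewrite -mulmx_sumr; congr (_ *m _); apply/row_matrixP => l.
rewrite rowK linear_sum (bigD1 l) //= big1 => [|i il].
  by rewrite addr0 evec_row eqxx scale1r /evec trmx_delta mulmxA -rowE !mulmxA.
by rewrite evec_row eq_sym (negPf il) scale0r.
Qed.

(** The factor [2^-1] is the averaging weight of [GCSH]; the two summands come from the simplex
    Hessians for [S, T] and for [- S, - T]. *)
Definition second_difference (R : realType) (n k : nat) (f : 'cV[R]_n -> R)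
    (x s : 'cV[R]_n) (T : 'M[R]_(n, k)) : 'cV[R]_k :=
  \col_j (2^-1 *
    ((f (x + s + col j T) - f (x + s) - f (x + col j T) + f x)
     + (f (x - s - col j T) - f (x - s) - f (x - col j T) + f x))).

Lemma simplex_gradientN (R : realType) (n k : nat) (f : 'cV[R]_n -> R)
  (x : 'cV[R]_n) (T : 'M[R]_(n, k)) :
  simplex_gradient f x (- T)
  = - (mp_inverse T^T *m \col_j (f (x - col j T) - f x)).
Proof.
rewrite /simplex_gradient linearN mp_inverseN mulNmx; congr (- (_ *m _)).
by apply/colP => j; rewrite !mxE linearN.
Qed.

(** In the second simplex Hessian the signs of [(- S^T)^+] and [(- T_i^T)^+] cancel, so both have
    the same outer factors and only the vectors of differences of [f] are averaged. *)
Lemma GCSH_rows (R : realType) (n m : nat) (k_ : 'I_m -> nat)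
  (f : 'cV[R]_n -> R) (x0 : 'cV[R]_n) (S : 'M[R]_(n, m))
  (T : forall i : 'I_m, 'M[R]_(n, k_ i)) :
  GCSH f x0 S T = mp_inverse S^T *m
    \matrix_(i < m) ((second_difference f x0 (col i S) (T i))^T
                     *m mp_inverse (T i)).
Proof.
rewrite /GCSH /GSH linearN mp_inverseN mulNmx -mulmxBr scalemxAr.
congr (_ *m _); apply/row_matrixP => i.
rewrite linearZ linearB /= !rowK -linearB -linearZ /=.
rewrite !simplex_gradientN linearN /simplex_gradient.
rewrite opprB opprK [X in _ + X]addrC -!mulmxBr -mulmxDr scalemxAr.
rewrite mp_inverse_trmx trmx_mul trmxK; congr (_^T *m _).
by apply/colP => j; rewrite !mxE; ring.
Qed.

(** Full column rank of [S] gives [S^T (S^T)^+ = 1], which recovers the rows, and [T_i T_i^+] is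
    absorbed by the [T_i^+] that ends each row. Full row rank gives [T_i T_i^+ = 1], and the
    remaining [(S^T)^+ S^T] is absorbed by [(S^T)^+]. *)
Lemma Proj_GCSH (R : realType) (n m : nat) (k_ : 'I_m -> nat)
  (f : 'cV[R]_n -> R) (x0 : 'cV[R]_n) (S : 'M[R]_(n, m))
  (T : forall i : 'I_m, 'M[R]_(n, k_ i)) :
  \rank S = m \/ (forall i, \rank (T i) = n) ->
  Proj S T (GCSH f x0 S T) = GCSH f x0 S T.
Proof.
rewrite Proj_rows GCSH_rows => -[rS|rT].
  congr (_ *m _); apply/row_matrixP => i; rewrite !rowK mulmxA -row_mul.
  rewrite row_free_mp_inverse; last by rewrite /row_free mxrank_tr rS.
  rewrite -row_mul mul1mx rowK -!mulmxA; congr (_ *m _); rewrite mulmxA.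
  by have [] := mp_inverseP (T i).
set M := \matrix_i ((second_difference _ _ _ _)^T *m _).
transitivity (mp_inverse S^T *m (S^T *m (mp_inverse S^T *m M))).
  congr (_ *m _); apply/row_matrixP => i; rewrite rowK -mulmxA.
  rewrite row_free_mp_inverse; last by rewrite /row_free rT.
  by rewrite mulmx1 row_mul.
by rewrite !mulmxA; have [_ -> _ _] := mp_inverseP S^T.
Qed.

(** With a common matrix the projection multiplies by [(S^T)^+ S^T] on the left and by [Tb Tb^+] on
    the right; the Penrose equations absorb both. *)
Lemma Proj_GCSH_const (R : realType) (n m k : nat)
  (f : 'cV[R]_n -> R) (x0 : 'cV[R]_n) (S : 'M[R]_(n, m)) (Tb : 'M[R]_(n, k)) :
  Proj S (fun=> Tb) (GCSH f x0 S (fun=> Tb)) = GCSH f x0 S (fun=> Tb).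
Proof.
rewrite Proj_const GCSH_rows !mulmxA; have [_ -> _ _] := mp_inverseP S^T.
rewrite -!mulmxA; congr (_ *m _); apply/row_matrixP => i.
rewrite row_mul !rowK -mulmxA; congr (_ *m _); rewrite mulmxA.
by have [] := mp_inverseP Tb.
Qed.

(** The points [x0 + s], [x0 + s + t] and [x0 - s + t] lie in the closed balls of the hypothesis.
    The bound on [t] uses both signs: [t] is half the sum of [s + t] and [- s + t]. *)
Lemma admissible_enorm_lt (R : realType) (n m : nat) (k_ : 'I_m -> nat)
  (x0 : 'cV[R]_n) (d : R) (S : 'M[R]_(n, m))
  (T : forall i : 'I_m, 'M[R]_(n, k_ i)) i j :
  admissible x0 d S T ->
  [/\ enorm (col i S) < d, enorm (col j (T i)) < d
    & enorm (col i S + col j (T i)) < d].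
Proof.
move=> [_ _ /(_ i) [plus minus]].
set s := col i S in plus minus *; set t := col j (T i).
have tr : enorm t <= col_radius (T i) by exact: col_radius_ge.
have sub0 (v : 'cV[R]_n) : x0 + v - x0 = v by rewrite addrAC subrr add0r.
have subt (v : 'cV[R]_n) : v + t - v = t by rewrite addrAC subrr add0r.
have sd : enorm s < d.
  have := plus (x0 + s); rewrite /eball /eclosed_ball /= subrr sub0 enorm0.
  by apply; apply: le_trans tr; exact: enorm_ge0.
have std : enorm (s + t) < d.
  have := plus (x0 + s + t).
  by rewrite /eball /eclosed_ball /= subt -(addrA x0) sub0; apply.
have mstd : enorm (- s + t) < d.
  have := minus (x0 - s + t).
  by rewrite /eball /eclosed_ball /= subt -(addrA x0) sub0; apply.
split=> //; have -> : t = 2^-1 *: (s + t + (- s + t)).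
  rewrite addrACA subrr add0r -mulr2n -(scaler_nat 2 t) scalerA.
  by rewrite mulVf ?scale1r.
rewrite enormZ ger0_norm ?invr_ge0 //.
have := enormD (s + t) (- s + t); lra.
Qed.

(** The entries of the difference vectors are at most [2 L r^4]; their number gives the [sqrt k_i]
    collected in [c], and the number of rows gives [sqrt m]. Leaving [c] free allows different radii
    in the two cases of the theorem. *)
Lemma GCSH_error_le (R : realType) (n m : nat) (k_ : 'I_m -> nat)
  (domf : set 'cV[R]_n) (f : 'cV[R]_n -> R) (x0 : 'cV[R]_n) (d L c r : R)
  (S : 'M[R]_(n, m)) (T : forall i : 'I_m, 'M[R]_(n, k_ i)) :
  0 <= L -> class_C domf 4 f (eball x0 d) ->
  third_derivative_lipschitz domf f L (eclosed_ball x0 d) ->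
  admissible x0 d S T ->
  (forall i, enorm (col i S) <= r) ->
  (forall i j, enorm (col j (T i)) <= r) ->
  0 <= c -> (forall i, specnorm (mp_inverse (T i)) * Num.sqrt (k_ i)%:R <= c) ->
  specnorm (GCSH f x0 S T - Proj S T (hessian f x0))
  <= specnorm (mp_inverse S^T) * (Num.sqrt m%:R * (c * (2 * L * r ^+ 4))).
Proof.
move=> L0 fC4 lipf adm Sr Tr c0 Tc.
have rhs0 : 0 <= 2 * L * r ^+ 4.
  by rewrite mulr_ge0 ?exprn_even_ge0 // mulr_ge0.
rewrite Proj_rows GCSH_rows -mulmxBr; apply: le_trans (specnormM _ _) _.
rewrite ler_wpM2l ?specnorm_ge0 //; apply: specnorm_rows_le => [|i].
  exact: mulr_ge0.
set v := second_difference f x0 (col i S) (T i)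
  - ((row i S^T *m hessian f x0 *m T i)^T).
have -> : (row i (\matrix_i0 ((second_difference f x0 (col i0 S) (T i0))^T
      *m mp_inverse (T i0)) -
    \matrix_i0 (row i0 S^T *m hessian f x0 *m T i0 *m mp_inverse (T i0))))^T
    = (mp_inverse (T i))^T *m v.
  by rewrite linearB /= !rowK -mulmxBl trmx_mul linearB /= trmxK.
apply: le_trans (enorm_mulmx_le _ _) _.
apply: (@le_trans _ _ (specnorm (mp_inverse (T i))
    * (Num.sqrt (k_ i)%:R * (2 * L * r ^+ 4)))).
  rewrite ler_pM ?specnorm_ge0 ?enorm_ge0 ?specnorm_trmx //.
  apply: enorm_col_le => // j.
  have [sd td std] := admissible_enorm_lt j adm.
  have -> : v j ord0 = second_difference f x0 (col i S) (T i) j ord0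
      - dotp (col i S) (hessian f x0 *m col j (T i)).
    rewrite /v mxE [X in _ + X]mxE; congr (_ - _).
    rewrite mxE -mulmxA mxE; apply: eq_bigr => l _; rewrite !mxE; congr (_ * _).
    by apply: eq_bigr => a _; rewrite !mxE.
  rewrite mxE; apply: le_trans (second_difference_le L0 fC4 lipf sd td std) _.
  have s0 := enorm_ge0 (col i S); have t0 := enorm_ge0 (col j (T i)).
  have sr := Sr i; have tr := Tr i j.
  have r0 : 0 <= r by exact: le_trans sr.
  (* The bound [2 L r^4] is the second-difference estimate with both norms replaced by [r]. *)
  have -> : 2 * L * r ^+ 4 = 2^-1 * (L * (r + r) ^+ 2 * r * r) by field.
  have sq_le : (enorm (col i S) + enorm (col j (T i))) ^+ 2 <= (r + r) ^+ 2.
    by rewrite ler_pXn2r ?nnegrE ?addr_ge0 // lerD.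
  have q0 : 0 <= L * (enorm (col i S) + enorm (col j (T i))) ^+ 2.
    by rewrite mulr_ge0 ?sqr_ge0.
  rewrite ler_wpM2l ?invr_ge0 //; apply: ler_pM => //; first exact: mulr_ge0.
  by apply: ler_pM => //; exact: ler_wpM2l.
by rewrite [leLHS]mulrA ler_wpM2r.
Qed.

(** * Comparison of the radii *)

Lemma radius_u_ge_S (R : realType) (n m : nat) (k_ : 'I_m -> nat)
  (S : 'M[R]_(n, m)) (T : forall i : 'I_m, 'M[R]_(n, k_ i)) :
  col_radius S <= radius_u S T.
Proof. exact: bigmax_ge_id. Qed.

Lemma radius_u_ge_T (R : realType) (n m : nat) (k_ : 'I_m -> nat)
  (S : 'M[R]_(n, m)) (T : forall i : 'I_m, 'M[R]_(n, k_ i)) i :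
  col_radius (T i) <= radius_u S T.
Proof. exact: (le_bigmax _ (fun j => col_radius (T j))). Qed.

Lemma radius_l_le_S (R : realType) (n m : nat) (k_ : 'I_m -> nat)
  (S : 'M[R]_(n, m)) (T : forall i : 'I_m, 'M[R]_(n, k_ i)) :
  radius_l S T <= col_radius S.
Proof. exact: bigmin_le_id. Qed.

Lemma radius_l_le_T (R : realType) (n m : nat) (k_ : 'I_m -> nat)
  (S : 'M[R]_(n, m)) (T : forall i : 'I_m, 'M[R]_(n, k_ i)) i :
  radius_l S T <= col_radius (T i).
Proof. exact: (bigmin_le _ i (fun j => col_radius (T j))). Qed.

Lemma radius_l_gt0 (R : realType) (n m : nat) (k_ : 'I_m -> nat)
  (S : 'M[R]_(n, m)) (T : forall i : 'I_m, 'M[R]_(n, k_ i)) :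
  S != 0 -> (forall i, T i != 0) -> 0 < radius_l S T.
Proof.
move=> S0 T0; apply: lt_bigmin => [|i _]; first exact: col_radius_gt0.
exact: col_radius_gt0.
Qed.

(** Of two radii one is the maximum and the other the minimum, so their product is that of
    [radius_u] and [radius_l]. The index [i] makes the radius of [Tb] enter the minimum. *)
Lemma radius_mul_le (R : realType) (n m k : nat) (S : 'M[R]_(n, m))
  (Tb : 'M[R]_(n, k)) (i : 'I_m) :
  S != 0 -> Tb != 0 ->
  radius_u S (fun=> Tb) * radius_l S (fun=> Tb) <= col_radius S * col_radius Tb.
Proof.
move=> S0 T0; set rS := col_radius S; set rT := col_radius Tb.
have rS0 : 0 <= rS by rewrite ltW // col_radius_gt0.
have rT0 : 0 <= rT by rewrite ltW // col_radius_gt0.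
have lS := radius_l_le_S S (fun _ : 'I_m => Tb); rewrite -/rS in lS.
have lT := radius_l_le_T S (fun _ : 'I_m => Tb) i; rewrite -/rT in lT.
have l0 : 0 < radius_l S (fun _ : 'I_m => Tb) by exact: radius_l_gt0.
have [ST|/ltW TS] := leP rS rT.
  rewrite mulrC ler_pM ?(ltW l0) //; last by apply: bigmax_le.
  by apply: le_trans (radius_u_ge_S _ _).
rewrite ler_pM ?(ltW l0) //; last by apply: bigmax_le.
by apply: le_trans (radius_u_ge_S _ _).
Qed.

Theorem theorem4p3 (R : realType) (n m : nat)
  (domf : set 'cV[R]_n) (f : 'cV[R]_n -> R)
  (x0 : 'cV[R]_n) (Delta L : R) (S : 'M[R]_(n, m))
  (x0_domf : domf x0) (Delta_gt0 : 0 < Delta)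
  (f_C4 : class_C domf 4 f (eball x0 Delta))
  (f_lip : third_derivative_lipschitz domf f L (eclosed_ball x0 Delta)) :
  (forall (k_ : 'I_m -> nat) (T : forall i : 'I_m, 'M[R]_(n, k_ i)),
     admissible x0 Delta S T ->
     \rank S = m \/ (forall i, \rank (T i) = n) ->
     forall i0 : 'I_m,
     (forall i, specnorm (mp_inverse (normalized (T i)))
                <= specnorm (mp_inverse (normalized (T i0)))) ->
     specnorm (Proj S T (GCSH f x0 S T) - Proj S T (hessian f x0))
       = specnorm (GCSH f x0 S T - Proj S T (hessian f x0)) /\
     specnorm (GCSH f x0 S T - Proj S T (hessian f x0))
       <= 2 * m%:R * Num.sqrt (\max_(i < m) k_ i)%N%:R * L
          * (radius_u S T / radius_l S T) ^+ 2
          * specnorm (mp_inverse (normalized S)^T)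
          * specnorm (mp_inverse (normalized (T i0)))
          * radius_u S T ^+ 2) /\
  (forall (k : nat) (Tbar : 'M[R]_(n, k)),
     let T := fun _ : 'I_m => Tbar in
     admissible x0 Delta S T ->
     specnorm (Proj S T (GCSH f x0 S T) - Proj S T (hessian f x0))
       = specnorm (GCSH f x0 S T - Proj S T (hessian f x0)) /\
     specnorm (GCSH f x0 S T - Proj S T (hessian f x0))
       <= 2 * Num.sqrt (m * k)%N%:R * L
          * (radius_u S T / radius_l S T)
          * specnorm (mp_inverse (normalized S)^T)
          * specnorm (mp_inverse (normalized Tbar))
          * radius_u S T ^+ 2).
Proof.
(* A nonzero entry of [S] provides a row index, hence a coordinate direction of the space. *)
have L_ge0 : S != 0 -> 0 <= L.
  by move=> /matrix0Pn [i _]; exact: (lipschitz_ge0 i Delta_gt0 f_lip).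
split=> [k_ T adm rk i0 i0_max|k Tbar T adm].
  have [S0 T0 _] := adm; have L0 := L_ge0 S0.
  split; first by rewrite Proj_GCSH.
  set K := (\max_(i < m) k_ i)%N; set ru := radius_u S T.
  set rl := radius_l S T; set tn := specnorm (mp_inverse (normalized (T i0))).
  set sn := specnorm (mp_inverse (normalized S)^T).
  have rl0 : 0 < rl by exact: radius_l_gt0.
  have ru0 : 0 <= ru.
    by apply: le_trans (radius_u_ge_S S T); rewrite ltW // col_radius_gt0.
  have tn0 : 0 <= tn by exact: specnorm_ge0.
  have sn0 : 0 <= sn by exact: specnorm_ge0.
  have c0 : 0 <= tn / rl * Num.sqrt K%:R.
    by rewrite mulr_ge0 ?sqrtr_ge0 // divr_ge0 // ltW.
  (* The rows give [sqrt m], the stated bound has [m]; they compare because [m <= m ^ 2] for every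
     natural number. *)
  have m_ge : Num.sqrt m%:R <= m%:R :> R.
    rewrite -[leRHS]ger0_norm // -sqrtr_sqr ler_wsqrtr // -natrX ler_nat.
    by case: (m) => // m'; rewrite expnS leq_pmulr // expn_gt0.
  have S_le : specnorm (mp_inverse S^T) <= sn / rl.
    apply: le_trans (specnorm_mp_inverse_normalized_trmx S0) _.
    by rewrite ler_wpM2l // lef_pV2 ?posrE ?col_radius_gt0 // radius_l_le_S.
  (* This [c] combines the largest pseudoinverse norm, the smallest radius and the largest [k_ i],
     so it serves every [i]. *)
  apply: le_trans (GCSH_error_le (c := tn / rl * Num.sqrt K%:R) (r := ru)
    L0 f_C4 f_lip adm _ _ c0 _) _.
  - by move=> i; apply: le_trans (col_radius_ge _ _) (radius_u_ge_S _ _).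
  - by move=> i j; apply: le_trans (col_radius_ge _ _) (radius_u_ge_T _ _ i).
  - move=> i; rewrite ler_pM ?specnorm_ge0 ?sqrtr_ge0 //; last first.
      by rewrite ler_wsqrtr // ler_nat leq_bigmax.
    apply: le_trans (specnorm_mp_inverse_normalized (T0 i)) _.
    rewrite ler_pM ?specnorm_ge0 ?invr_ge0 ?(ltW (col_radius_gt0 _)) //.
    by rewrite lef_pV2 ?posrE ?col_radius_gt0 // radius_l_le_T.
  (* One factor [1 / rl] comes from [S] and one from [T i]; with [ru ^+ 4] they form
     [(ru / rl) ^+ 2 * ru ^+ 2]. *)
  have -> : 2 * m%:R * Num.sqrt K%:R * L * (ru / rl) ^+ 2 * sn * tn * ru ^+ 2
      = sn / rl * (m%:R * (tn / rl * Num.sqrt K%:R * (2 * L * ru ^+ 4))).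
    by field; rewrite gt_eqF.
  have rhs0 : 0 <= tn / rl * Num.sqrt K%:R * (2 * L * ru ^+ 4).
    by rewrite !mulr_ge0 ?invr_ge0 ?sqrtr_ge0 ?(ltW rl0).
  apply: ler_pM => //; first exact: specnorm_ge0.
    by rewrite mulr_ge0 ?sqrtr_ge0.
  exact: ler_wpM2r.
have [S0 T0 _] := adm; have L0 := L_ge0 S0.
have [_ [i _]] := matrix0Pn _ S0; have Tb0 : Tbar != 0 := T0 i.
split; first by rewrite Proj_GCSH_const.
set ru := radius_u S T; set rl := radius_l S T.
set tn := specnorm (mp_inverse (normalized Tbar)).
set sn := specnorm (mp_inverse (normalized S)^T).
have rl0 : 0 < rl by exact: radius_l_gt0.
have rS0 := col_radius_gt0 S0; have rT0 := col_radius_gt0 Tb0.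
have ru0 : 0 < ru by exact: lt_le_trans rS0 (radius_u_ge_S S T).
have tn0 : 0 <= tn by exact: specnorm_ge0.
have sn0 : 0 <= sn by exact: specnorm_ge0.
(* Here [c] keeps the exact radius of [Tbar], so that the product of the two radii survives and a
   single factor [ru / rl] results. *)
have c0 : 0 <= tn / col_radius Tbar * Num.sqrt k%:R.
  by rewrite mulr_ge0 ?sqrtr_ge0 // divr_ge0 // ltW.
apply: le_trans (GCSH_error_le (c := tn / col_radius Tbar * Num.sqrt k%:R)
  (r := ru) L0 f_C4 f_lip adm _ _ c0 _) _.
- by move=> j; apply: le_trans (col_radius_ge _ _) (radius_u_ge_S _ _).
- by move=> j l; apply: le_trans (col_radius_ge _ _) (radius_u_ge_T _ _ i).
- move=> j; rewrite ler_wpM2r ?sqrtr_ge0 //.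
  exact: specnorm_mp_inverse_normalized.
have -> : 2 * Num.sqrt (m * k)%N%:R * L * (ru / rl) * sn * tn * ru ^+ 2
    = sn * (Num.sqrt m%:R * (tn * Num.sqrt k%:R * (2 * L * ru ^+ 4)))
      / (ru * rl).
  by rewrite natrM sqrtrM //; field; rewrite !gt_eqF.
have rhs0 : 0 <= Num.sqrt m%:R * (tn * Num.sqrt k%:R * (2 * L * ru ^+ 4)).
  by rewrite !mulr_ge0 ?sqrtr_ge0 ?(ltW ru0).
(* The intermediate bound has the exact denominator [Delta_S Delta_T], which [radius_mul_le]
   compares with [ru * rl]. *)
apply: (@le_trans _ _ (sn * (Num.sqrt m%:R *
    (tn * Num.sqrt k%:R * (2 * L * ru ^+ 4)))
    / (col_radius S * col_radius Tbar))).
  have -> : sn * (Num.sqrt m%:R * (tn * Num.sqrt k%:R * (2 * L * ru ^+ 4)))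
        / (col_radius S * col_radius Tbar)
      = sn / col_radius S * (Num.sqrt m%:R *
          (tn / col_radius Tbar * Num.sqrt k%:R * (2 * L * ru ^+ 4))).
    by field; rewrite !gt_eqF.
  rewrite ler_wpM2r ?specnorm_mp_inverse_normalized_trmx //.
  by rewrite !mulr_ge0 ?sqrtr_ge0 ?invr_ge0 ?(ltW ru0) ?(ltW rT0).
rewrite ler_wpM2l ?(mulr_ge0 sn0) // lef_pV2 ?posrE ?mulr_gt0 //.
exact: radius_mul_le.
Qed.
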